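(* Let $\mathbb{H}$ be a Hilbert space and let $S:\mathbb{H}\to\mathbb{H}$ be a linear operator (defined on a linear subspace $\operatorname{dom}(S)\subseteq\mathbb{H}$) such that $\operatorname{ran}(G(S)\cap G(S)^* )=\mathbb{H}$. Then the adjoint operator $S^*$ exists (i.e. $\operatorname{dom}(S)$ is dense in $\mathbb{H}$) and $S=S^*$.
   Context: A linear operator $S$ on $\mathbb{H}$ is a linear map $S:\operatorname{dom}(S)\to\mathbb{H}$, where $\operatorname{dom}(S)$ is a linear subspace of $\mathbb{H}$; it is not assumed to be everywhere defined, densely defined, closed or bounded. Ordered pairs in $\mathbb{H}\times\mathbb{H}$ are written $\{f,f'\}$. The graph of $S$ is $G(S)=\{\{f,Sf\}: f\in\operatorname{dom}(S)\}$. The adjoint of the graph is defined, whether or not $S$ is densely defined, by $$G(S)^*=\{\{f,f'\}\in\mathbb{H}\times\mathbb{H}: \langle f',h\rangle=\langle f,Sh\rangle \text{ for all } h\in\operatorname{dom}(S)\}.$$ If the adjoint operator $S^*$ exists, i.e. if $\operatorname{dom}(S)$ is dense, then $G(S^* )=G(S)^*$. For a linear subspace $T\subseteq\mathbb{H}\times\mathbb{H}$, $\operatorname{ran}(T)=\{f'\in\mathbb{H}: \{f,f'\}\in T \text{ for some } f\in\mathbb{H}\}$. Equality $S=S^*$ means equality as (possibly unbounded) operators, including equality of domains. *)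

(* Defs.v *)
From HB Require Import structures.
From mathcomp Require Import all_boot all_order all_algebra.
From mathcomp Require Import sesquilinear.
From mathcomp Require Import complex.
From mathcomp Require Import boolp classical_sets reals topology normedtype.

Set Implicit Arguments.
Unset Strict Implicit.
Unset Printing Implicit Defensive.
Import Order.TTheory GRing.Theory Num.Theory.
Import numFieldNormedType.Exports.
Local Open Scope classical_set_scope.
Local Open Scope ring_scope.

(* Scalars of a Hilbert space, with their conjugation: the real numbers or the
   complex numbers, the real numbers being given by an arbitrary realType. *)
Inductive real_or_complex : forall K : numFieldType, (K -> K) -> Prop :=
| real_scalars (R : realType) : @real_or_complex R idfun
| complex_scalars (R : realType) : @real_or_complex R[i] conjc.

(* An inner product inducing the given norm; it is linear in the first argument
   and [theta]-linear in the second. On a [completeNormedModType], this is the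
   structure of a Hilbert space. *)
Record inner_product (K : numFieldType) (theta : K -> K) (H : normedModType K) :=
  InnerProduct {
    inner :> {dot H for theta};
    inner_norm : forall x : H, inner x x = `|x| ^+ 2
  }.

(* The values of [app] are only given on the domain, so that the Leibniz equality
   of operators is equality of the domains and of the values. *)
Record linear_operator (K : numFieldType) (H : lmodType K) := LinearOperator {
  dom : set H;
  app :> dom -> H;
  dom0 : dom 0;
  domP : forall (a : K) (x y : H), dom x -> dom y -> dom (a *: x + y);
  appP : forall (a : K) (x y z : dom),
    val z = a *: val x + val y -> app z = a *: app x + app y
}.

Definition graph (K : numFieldType) (H : lmodType K) (S : linear_operator H) :
  set (H * H) := range (fun f : dom S => (val f, S f)).

Lemma graph_inj (K : numFieldType) (H : lmodType K) :
  injective (@graph K H).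
Proof.
have graph_dom (S : linear_operator H) : dom S = (graph S).`1.
  apply/seteqP; split => [f Sf|f [f' [g _ [<- _]]]]; last exact: set_mem (valP g).
  by exists (S (exist _ f (mem_set Sf))), (exist _ f (mem_set Sf)).
move=> S T ST; have : dom S = dom T by rewrite !graph_dom ST.
case: S T ST => [D A D0 DP AP] [E B E0 EP BP] ST /= DE.
case: E / DE in B E0 EP BP ST *.
have AB : A = B.
  apply: funext => f; have : graph (LinearOperator E0 EP BP) (val f, A f) by rewrite -ST; exists f.
  by move=> [g _ [/val_inj -> ->]].
case: B / AB in BP ST *.
by congr LinearOperator; exact: Prop_irrelevance.
Qed.

Definition adjoint_graph (K : numFieldType) (theta : K -> K)
    (H : normedModType K) (ip : inner_product theta H) (S : linear_operator H) :
    set (H * H) :=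
  [set p | forall h : dom S, ip p.2 (val h) = ip p.1 (S h)].

Definition ran (T : Type) (A : set (T * T)) : set T :=
  [set f' | exists f, A (f, f')].

Section Adjoint.
Variables (K : numFieldType) (theta : K -> K) (H : normedModType K).
Variables (ip : inner_product theta H) (S : linear_operator H).

Lemma innerBl (x y z : H) : ip (x - y) z = ip x z - ip y z.
Proof. exact: (zmod_morphisml_subproof z). Qed.

Lemma inner0l (z : H) : ip 0 z = 0.
Proof. by rewrite -(subrr 0) innerBl subrr. Qed.

Lemma innerDl (x y z : H) : ip (x + y) z = ip x z + ip y z.
Proof.
by rewrite -{1}[y]opprK innerBl -[- y]sub0r innerBl inner0l sub0r opprK.
Qed.

Lemma innerBr (x y z : H) : ip x (y - z) = ip x y - ip x z.
Proof. exact: (zmod_morphismr_subproof x). Qed.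

Lemma innerZl (a : K) (x z : H) : ip (a *: x) z = a * ip x z.
Proof. exact: (linearl_subproof z). Qed.

Lemma innerC (x y : H) : ip x y = theta (ip y x).
Proof. by rewrite [LHS]hermitian_subproof expr0 mul1r. Qed.

Lemma adjoint_graph_linear (a : K) (f f' g g' : H) :
  adjoint_graph ip S (f, f') -> adjoint_graph ip S (g, g') ->
  adjoint_graph ip S (a *: f + g, a *: f' + g').
Proof. by move=> fP gP h; rewrite /= !innerDl !innerZl (fP h) (gP h). Qed.

Lemma adjoint_graph0 : adjoint_graph ip S (0, 0).
Proof. by move=> h; rewrite !inner0l. Qed.

Hypothesis denseS : dense (dom S).

Lemma dense_orthogonal (x : H) : (forall h, dom S h -> ip x h = 0) -> x = 0.
Proof.
move=> xS; apply/eqP; apply/negPn/negP => xN0.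
have nx0 : 0 < `|x| by rewrite normr_gt0.
have [||y [xy Sy]] := @denseS (interior (ball x `|x|)).
- by exists x; exact: nbhsx_ballx.
- exact: open_interior.
move/interior_subset : xy; rewrite -ball_normE /= => xy.
suff: `|x| ^+ 2 <= `|x - y| ^+ 2.
  rewrite ler_sqr ?nnegrE ?normr_ge0 // => xxy.
  by have := lt_le_trans xy xxy; rewrite ltxx.
have theta0 : theta 0 = 0.
  by rewrite -{1}(inner0l 0) -innerC inner0l.
have yx0 : ip y x = 0 by rewrite innerC (xS _ Sy) theta0.
rewrite -!(inner_norm ip) innerBl !innerBr (xS _ Sy) yx0 subr0 sub0r opprK.
by rewrite lerDl inner_norm exprn_ge0.
Qed.

Lemma adjoint_graph_functional (f f' f'' : H) :
  adjoint_graph ip S (f, f') -> adjoint_graph ip S (f, f'') -> f' = f''.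
Proof.
move=> f'P f''P; apply/eqP; rewrite -subr_eq0; apply/eqP.
apply: dense_orthogonal => h Sh.
have := f'P (exist _ h (mem_set Sh)); have := f''P (exist _ h (mem_set Sh)).
by rewrite /= innerBl => -> ->; rewrite subrr.
Qed.

Definition adjoint_dom : set H := [set f | exists f', adjoint_graph ip S (f, f')].

Definition adjoint_app (f : adjoint_dom) : H := projT1 (cid (set_mem (valP f))).

Lemma adjoint_appP (f : adjoint_dom) : adjoint_graph ip S (val f, adjoint_app f).
Proof. exact: projT2 (cid (set_mem (valP f))). Qed.

Lemma adjoint_dom0 : adjoint_dom 0.
Proof. by exists 0; exact: adjoint_graph0. Qed.

Lemma adjoint_domP (a : K) (x y : H) :
  adjoint_dom x -> adjoint_dom y -> adjoint_dom (a *: x + y).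
Proof.
by move=> [x' xP] [y' yP]; exists (a *: x' + y'); exact: adjoint_graph_linear.
Qed.

Lemma adjoint_app_linear (a : K) (x y z : adjoint_dom) :
  val z = a *: val x + val y ->
  adjoint_app z = a *: adjoint_app x + adjoint_app y.
Proof.
move=> zE; apply: (@adjoint_graph_functional (val z)); first exact: adjoint_appP.
by rewrite zE; apply: adjoint_graph_linear; exact: adjoint_appP.
Qed.

Definition adjoint : linear_operator H :=
  LinearOperator adjoint_dom0 adjoint_domP adjoint_app_linear.

Lemma graph_adjoint : graph adjoint = adjoint_graph ip S.
Proof.
apply/seteqP; split => [_ [f _ <-]|[f f'] fP]; first exact: adjoint_appP.
have Df : adjoint_dom f by exists f'.
exists (exist _ f (mem_set Df)) => //; congr pair.
by apply: (@adjoint_graph_functional f) => //; exact: adjoint_appP.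
Qed.
End Adjoint.

(* Main.v *)
(** Let T be the intersection of the graph of S with its adjoint. Since ran T is
    the whole space, so is ran S. If x is orthogonal to dom S, write
    {f, x} in T; then <f, S h> = <x, h> = 0 for all h, so f = 0 and x = S 0 = 0.
    By completeness (projection theorem), dom S is dense. Given {f, f'} in G(S)
    or in G(S)*, take {g, f'} in T. If {f, f'} is in G(S), then f - g is in
    ker S, which is orthogonal to ran T; if it is in G(S)*, then f - g is
    orthogonal to ran S. In both cases f = g, so G(S) = T = G(S)*. *)

Require Import Defs.
From mathcomp Require Import all_boot all_order all_algebra.
From mathcomp Require Import complex ring.
From mathcomp Require Import boolp classical_sets reals topology normedtype.

Set Implicit Arguments.
Unset Strict Implicit.
Unset Printing Implicit Defensive.
Import Order.TTheory GRing.Theory Num.Theory.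
Import numFieldNormedType.Exports.
Local Open Scope classical_set_scope.
Local Open Scope ring_scope.

(** * Conjugation and infima of scalars *)

Section Scalars.
Variables (K : numFieldType) (theta : K -> K).
Hypothesis KP : real_or_complex theta.

Lemma theta_mul_norm (b : K) : b * theta b = `|b| ^+ 2.
Proof.
case: KP b => R b; last by rewrite sqr_normc.
by rewrite /= real_normK ?num_real// expr2.
Qed.

Lemma theta_ge0 (r : K) : 0 <= r -> theta r = r.
Proof.
by case: KP r => // R [a b]; rewrite lecE /= => /andP[/eqP -> _]; rewrite oppr0.
Qed.

(** Nonnegative complex numbers are real in the order of [R[i]], so the infimum of the real parts
    serves in the complex case. *)
Lemma nonneg_approx_inf (A : set K) :
  A !=set0 -> (forall a, A a -> 0 <= a) ->
  exists d, (forall a, A a -> d <= a) /\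
    forall e, 0 < e -> exists2 a, A a & a < d + e.
Proof.
have real_inf (R : realType) (B : set R) : B !=set0 -> (forall b, B b -> 0 <= b) ->
    exists d, (forall b, B b -> d <= b) /\
      forall e, 0 < e -> exists2 b, B b & b < d + e.
  move=> B0 B_ge0; have lbB : has_lbound B by exists 0 => b /B_ge0.
  by exists (inf B); split=> [b /(ge_inf lbB)|e e0] //; exact: inf_adherent.
case: KP A => [|R A A0 A_ge0]; first exact: real_inf.
have A_real a : A a -> a = (complex.Re a)%:C%C.
  by move/A_ge0; case: a => a b; rewrite lecE => /andP[/eqP/= -> _].
have [||d [dA dlt]] := real_inf R ((@complex.Re R) @` A).
- by case: A0 => a Aa; exists (complex.Re a), a.
- by move=> _ [a /A_ge0 + <-]; rewrite lecE => /andP[].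
exists (d%:C)%C; split=> [a Aa|[e ei]].
  by rewrite (A_real _ Aa) lecR; apply: dA; exists a.
rewrite ltcE /= => /andP[/eqP -> e0].
have [_ [a Aa <-] alt] := dlt _ e0; exists a => //.
by rewrite (A_real _ Aa) ltcE /= addr0 eqxx.
Qed.

End Scalars.

(** * Inner product identities and Cauchy-Schwarz *)

Section InnerProduct.
Variables (K : numFieldType) (theta : K -> K) (H : normedModType K).
Variable ip : inner_product theta H.

Lemma theta0 : theta 0 = 0.
Proof. by rewrite -{1}(inner0l ip 0) -innerC inner0l. Qed.

Lemma inner0r (x : H) : ip x 0 = 0.
Proof. by rewrite innerC inner0l theta0. Qed.

Lemma innerDr (x y z : H) : ip x (y + z) = ip x y + ip x z.
Proof.
by rewrite -{1}[z]opprK innerBr -[- z]sub0r innerBr inner0r sub0r opprK.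
Qed.

Lemma inner_eq0 (x : H) : ip x x = 0 -> x = 0.
Proof. by rewrite inner_norm => /eqP; rewrite expf_eq0 normr_eq0 => /eqP. Qed.

Lemma parallelogram (x y : H) :
  `|x + y| ^+ 2 + `|x - y| ^+ 2 = 2 * (`|x| ^+ 2 + `|y| ^+ 2).
Proof.
rewrite -!(inner_norm ip) !(innerBl, innerDl) !(innerBr, innerDr); ring.
Qed.

Hypothesis KP : real_or_complex theta.

(* With b = <v, h>, the choice a = b / |h|^2 gives
   |v - a h|^2 = |v|^2 - |b|^2 / |h|^2. *)
Lemma inner_almost_minimal (v h : H) (e : K) :
  (forall a, `|v| ^+ 2 <= `|v - a *: h| ^+ 2 + e) ->
  `|ip v h| ^+ 2 <= e * `|h| ^+ 2.
Proof.
have [->|hN0] := eqVneq h 0; first by rewrite inner0r !normr0 expr0n /= mulr0.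
have n_gt0 : 0 < `|h| ^+ 2 by rewrite exprn_gt0 // normr_gt0.
set n := `|h| ^+ 2 in n_gt0 *; set b := ip v h; set a := b / n.
move=> /(_ a); rewrite -[`|v - _| ^+ 2](inner_norm ip) innerBl innerZl.
(* The residual [v - a *: h] is orthogonal to [h], so its squared norm reduces to its product with
   [v]. *)
have -> : ip h (v - a *: h) = 0.
  rewrite innerC innerBl innerZl inner_norm -/n -/b /a divfK ?gt_eqF //.
  by rewrite subrr theta0.
rewrite mulr0 subr0 innerBr inner_norm.
have -> : ip v (a *: h) = `|b| ^+ 2 / n.
  have ab : a * theta b = `|b| ^+ 2 / n by rewrite -(theta_mul_norm KP b) mulrAC.
  rewrite innerC innerZl [ip h v]innerC -/b ab (theta_ge0 KP) //.
  by rewrite divr_ge0 ?exprn_ge0 // ltW.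
by rewrite -addrA lerDl addrC subr_ge0 ler_pdivrMr.
Qed.

(** Take [e] to be the squared norm of [v] in [inner_almost_minimal]; its hypothesis is then
    trivial. *)
Lemma inner_cauchy_schwarz (v h : H) : `|ip v h| <= `|v| * `|h|.
Proof.
rewrite -ler_sqr ?nnegrE ?mulr_ge0 // exprMn; apply: inner_almost_minimal => a.
by rewrite lerDr exprn_ge0.
Qed.

End InnerProduct.

(** * Projection onto the closure of a subspace *)

Section Projection.
Variables (K : numFieldType) (theta : K -> K) (H : completeNormedModType K).
Variables (ip : inner_product theta H) (D : set H).
Hypothesis KP : real_or_complex theta.
Hypotheses (D0 : D 0) (DP : forall (a : K) x y, D x -> D y -> D (a *: x + y)).

Lemma orthogonal_projection (x : H) :
  exists2 p, closure D p & forall h, D h -> ip (x - p) h = 0.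
Proof.
have [||d [dle dlt]] := @nonneg_approx_inf K theta KP
    ((fun y => `|x - y| ^+ 2) @` D).
- by exists (`|x - 0| ^+ 2), 0.
- by move=> _ [y _ <-]; rewrite exprn_ge0.
have dD y : D y -> d <= `|x - y| ^+ 2 by move=> Dy; apply: dle; exists y.
(* By the parallelogram law, the filter of the almost minimizers in D of the
   distance to x is Cauchy. *)
pose B e := D `&` [set y | `|x - y| ^+ 2 < d + e].
pose F := filter_from [set e : K | 0 < e] B.
have FF : ProperFilter F.
  apply: filter_from_proper => [|e /dlt[_ [y Dy <-] ylt]]; last by exists y.
  apply: filter_from_filter => [|i j i0 j0]; first by exists 1 => /=.
  (* The order on [K] may be partial, but positive scalars are real and hence comparable. *)
  have ij : i >=< j by apply: real_comparable; exact: gtr0_real.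
  exists (Order.min i j); first by rewrite /= comparable_lt_min // i0.
  move=> y [Dy]; rewrite /= => ylt; split; split=> //=; apply: (lt_le_trans ylt);
  by rewrite lerD2l comparable_ge_min // lexx ?orbT.
(* The midpoint of [y] and [z] lies in [D], so its squared distance to [x] is at least [d]; the
   parallelogram law gives a bound of 4(d + e) - 4d. *)
have B_close e y z : B e y -> B e z -> `|y - z| ^+ 2 < 4 * e.
  move=> [Dy ylt] [Dz zlt].
  have := parallelogram ip (x - z) (x - y).
  have -> : x - z - (x - y) = y - z by rewrite opprB addrC addrA subrK.
  move=> /(canRL (addKr _)) ->.
  have -> : x - z + (x - y) = 2 *: (x - 2^-1 *: (z + y)).
    rewrite scalerBr scalerA divff ?pnatr_eq0 // scale1r scaler_nat mulr2n.
    by rewrite addrACA -opprD.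
  have Dm : D (2^-1 *: (z + y)).
    rewrite -[_ *: _]addr0; apply: DP => //.
    by rewrite -[z]scale1r; exact: DP.
  rewrite normrZ exprMn ger0_norm // addrC ltrBlDr.
  have -> : 4 * e + 2 ^+ 2 * `|x - 2^-1 *: (z + y)| ^+ 2 =
    2 * (2 * (`|x - 2^-1 *: (z + y)| ^+ 2 + e)) by ring.
  rewrite ltr_pM2l // mulr_natl mulr2n.
  by apply: ltrD; [apply: lt_le_trans zlt _|apply: lt_le_trans ylt _];
    rewrite lerD2r dD.
have cauchyF : cauchy F.
  apply: cauchy_exP => e e0.
  have e40 : 0 < e ^+ 2 / 4 by rewrite divr_gt0 // exprn_gt0.
  have [_ [y Dy <-] ylt] := dlt _ e40.
  exists y, (e ^+ 2 / 4) => // z Bz.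
  rewrite -ball_normE /= -ltr_sqr ?nnegrE ?(ltW e0) //.
  have -> : e ^+ 2 = 4 * (e ^+ 2 / 4) by rewrite mulrC divfK ?pnatr_eq0.
  exact: B_close.
have [p Fp] := (cvg_ex F).1 (cauchy_cvg F cauchyF).
have near_p e (r : K) : 0 < e -> 0 < r -> exists2 y, B e y & `|y - p| < r.
  move=> e0 r0.
  have Fb : F (ball p r) by apply: Fp; exact: nbhsx_ballx.
  have FB : F (B e) by exists e.
  have [y [By]] := filter_ex (filterI FB Fb).
  by rewrite -ball_normE /= distrC; exists y.
exists p.
  move=> U /(Fp U) FU.
  have FB : F (B 1) by exists 1 => //=.
  by have [y [[Dy _] Uy]] := filter_ex (filterI FB FU); exists y.
move=> h Dh; apply/eqP; rewrite -normr_eq0; apply/negPn/negP => bN0.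
set b := `|_| in bN0; have b0 : 0 < b by rewrite lt_neqAle eq_sym bN0 /b /=.
have h1_gt0 : 0 < `|h| + 1 by rewrite ltr_wpDl.
(* Chosen so that b = 2r(|h| + 1). Split x - p as (y - p) + (x - y): Cauchy-Schwarz bounds the first
   product with [h] by r(|h| + 1), almost minimality of [y] with error r^2 bounds the second by
   r|h|. The added 1 makes the total strictly less than [b]. *)
pose r := b / (2 * (`|h| + 1)).
have r0 : 0 < r by rewrite divr_gt0 // mulr_gt0.
have [y [Dy ylt] yp] := near_p (r ^+ 2) r (exprn_gt0 2 r0) r0.
have : b < b; last by rewrite ltxx.
have {2}-> : b = r * (`|h| + 1) + r * (`|h| + 1).
  by rewrite /r; field; rewrite gt_eqF.
rewrite /b -[x - p](subrK (x - y)) innerDl.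
apply: le_lt_trans (ler_normD _ _) _; apply: ler_ltD.
  have -> : x - p - (x - y) = y - p by rewrite addrC opprB addrA subrK.
  apply: le_trans (inner_cauchy_schwarz ip KP _ _) _.
  by apply: ler_pM => //; [exact: ltW|rewrite lerDl].
apply: (@le_lt_trans _ _ (r * `|h|)); last by rewrite ltr_pM2l // ltrDl.
have rh_ge0 : 0 <= r * `|h| by rewrite mulr_ge0 // ltW.
rewrite -ler_sqr ?nnegrE // exprMn.
apply: inner_almost_minimal => // a.
apply: le_trans (ltW ylt) _; rewrite lerD2r -addrA -opprD.
by apply: dD; rewrite addrC; exact: DP.
Qed.

(** Each [x] equals its projection, since their difference is orthogonal to [D]; hence [x] lies in
    the closure. *)
Lemma dense_of_trivial_orthogonal :
  (forall x, (forall h, D h -> ip x h = 0) -> x = 0) -> dense D.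
Proof.
move=> D_orth O [x Ox] openO.
have [p Dp xp] := orthogonal_projection x.
have /D_orth /subr0_eq xE := xp.
by rewrite setIC; apply: Dp; rewrite -xE; exact: open_nbhs_nbhs.
Qed.

End Projection.

(** * Graphs as linear functional relations *)

Section Graph.
Variables (K : numFieldType) (H : lmodType K) (S : linear_operator H).

Lemma graph0 : graph S (0, 0).
Proof.
exists (exist _ 0 (mem_set (dom0 S))) => //; congr pair.
set z := exist _ _ _.
(* Writing 0 = -0 + 0 in the domain gives S 0 = -S 0 + S 0 = 0. *)
by rewrite (Defs.appP (a := -1) (x := z) (y := z)) /= ?scaleN1r ?addNr.
Qed.

Lemma graph_functional (f f' f'' : H) :
  graph S (f, f') -> graph S (f, f'') -> f' = f''.
Proof. by move=> [g _ [<- <-]] [k _ [/val_inj -> ->]]. Qed.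

Lemma graphB (f f' g g' : H) :
  graph S (f, f') -> graph S (g, g') -> graph S (f - g, f' - g').
Proof.
move=> [u _ [<- <-]] [v _ [<- <-]].
have Duv : dom S ((-1) *: val v + val u).
  by apply: domP; exact: set_mem (valP _).
exists (exist (fun f => f \in dom S) _ (mem_set Duv)) => //.
by rewrite (Defs.appP (a := -1) (x := v) (y := u)) // /= !scaleN1r !(addrC (- _)).
Qed.

End Graph.

Theorem theorem2p3 (K : numFieldType) (theta : K -> K)
    (KP : real_or_complex theta) (H : completeNormedModType K)
    (ip : inner_product theta H) (S : linear_operator H) :
  ran (graph S `&` adjoint_graph ip S) = setT ->
  exists denseS : dense (dom S), S = adjoint ip denseS.
Proof.
move=> ranT.
have surj x : exists f, graph S (f, x) /\ adjoint_graph ip S (f, x).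
  have : [set: H] x by [].
  by rewrite -ranT => -[f fx]; exists f.
have orth_ran x : (forall h, ip x (S h) = 0) -> x = 0.
  move=> xS; have [f [[h _ [_ hx]] _]] := surj x.
  by apply: (inner_eq0 (ip := ip)); rewrite -{2}hx.
have denseS : dense (dom S).
  apply: (dense_of_trivial_orthogonal (ip := ip)) => //; [exact: dom0|exact: domP|].
  move=> x xS; have [f [Gf Af]] := surj x.
  have f0 : f = 0.
    by apply: orth_ran => h; rewrite -(Af h) /= xS //; exact: set_mem (valP h).
  by move: Gf; rewrite f0 => /graph_functional; apply; exact: graph0.
exists denseS; apply: graph_inj; rewrite graph_adjoint.
apply/seteqP; split=> [[f f'] Gf|[f f'] Af]; have [g [Gg Ag]] := surj f'.
  suff -> : f = g by [].
  apply: subr0_eq; apply: (inner_eq0 (ip := ip)).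
  have [u _ [uE u0]] : graph S (f - g, 0) by rewrite -(subrr f'); exact: graphB.
  (* With {k, f - g} in the adjoint graph, <f - g, f - g> = <k, S (f - g)> = <k, 0> = 0. *)
  have [k [_ Ak]] := surj (f - g).
  by rewrite -{2}uE (Ak u) u0 inner0r.
suff -> : f = g by [].
by apply: subr0_eq; apply: orth_ran => h; rewrite innerBl -(Af h) -(Ag h) subrr.
Qed.
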